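(* Let $\omega\in\Omega=\{0,1,2\}^{\mathbb N}$. If $\omega$ is eventually constant, then the group $\tilde G_\omega$ is of polynomial growth; if $\omega$ is not eventually constant, then $\tilde G_\omega$ is of intermediate growth.
   Context: Let $T_2$ be the infinite binary rooted tree whose vertices are the finite words over $\{0,1\}$ (the root is the empty word, the children of $v$ are $v0$ and $v1$). Let $P$ denote the action at a vertex $v$ that interchanges the two subtrees rooted at $v0$ and $v1$ (sending $v0w\mapsto v1w$ and $v1w\mapsto v0w$), and let $I$ denote the trivial action. A sequence $(a_n)_{n\ge1}$ with $a_n\in\{P,I\}$ is identified with the automorphism of $T_2$ that acts as $a_n$ at the vertex $1^{n-1}0$ for each $n\ge1$ and trivially at all other vertices. Let $a\in\mathrm{Aut}(T_2)$ act as $P$ at the root and trivially at all other vertices, and let $x$ be the automorphism given by the constant sequence $(P,P,P,\dots)$. For $\omega=\omega_1\omega_2\cdots\in\Omega=\{0,1,2\}^{\mathbb N}$ let $b_\omega,c_\omega,d_\omega$ be the automorphisms given by the sequences $(b_n),(c_n),(d_n)$, where $b_n=I$ if $\omega_n=2$ and $b_n=P$ otherwise; $c_n=I$ if $\omega_n=1$ and $c_n=P$ otherwise; $d_n=I$ if $\omega_n=0$ and $d_n=P$ otherwise. The generalized Grigorchuk overgroup $\tilde G_\omega$ is the subgroup of $\mathrm{Aut}(T_2)$ generated by $a,b_\omega,c_\omega,d_\omega,x$. For a group $G$ with finite generating set $S$, $\gamma_{G,S}(n)$ is the number of elements of $G$ that can be written as a product of at most $n$ generators from $S$. $G$ has polynomial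 growth if $\gamma_{G,S}$ is bounded above by a polynomial in $n$; it has exponential growth if $\lim_n\gamma_{G,S}(n)^{1/n}>1$; it has intermediate growth if its growth is neither polynomial nor exponential. These properties do not depend on $S$. *)

(* Defs.v *)
From HB Require Import structures.
From mathcomp Require Import all_boot all_order all_algebra finmap.
From mathcomp Require Import all_classical all_reals all_analysis.

Set Implicit Arguments.
Unset Strict Implicit.
Unset Printing Implicit Defensive.

Import Order.TTheory GRing.Theory Num.Theory.
Import numFieldNormedType.Exports.

Local Open Scope classical_set_scope.

(* Vertices of the binary rooted tree: words over {0, 1}, with [false] for 0
   and [true] for 1. The head of the list is the first letter, so the children
   of [v] are [rcons v false] and [rcons v true]. *)
Definition vertex := seq bool.

Definition is_tree_aut (f : vertex -> vertex) : Prop :=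
  [/\ bijective f, f [::] = [::] &
      forall v x, exists y, f (rcons v x) = rcons (f v) y].

Definition tree_aut := {f : vertex -> vertex | `[< is_tree_aut f >]}.

HB.instance Definition _ := Choice.on tree_aut.

Definition aut_fun (g : tree_aut) : vertex -> vertex := val g.
Coercion aut_fun : tree_aut >-> Funclass.

Definition mk_aut f (hf : is_tree_aut f) : tree_aut :=
  exist _ f (asboolT hf).

Lemma tree_autP (g : tree_aut) : is_tree_aut g.
Proof. exact/asboolP/(valP g). Qed.

Lemma tree_aut_ext (g h : tree_aut) : g =1 h -> g = h.
Proof. by move=> gh; apply/val_inj/funext. Qed.

Lemma is_tree_aut_id : is_tree_aut id.
Proof. by split=> [||v x]; [exists id | | exists x]. Qed.

Lemma is_tree_aut_comp f g :
  is_tree_aut f -> is_tree_aut g -> is_tree_aut (f \o g).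
Proof.
move=> [fb f0 fc] [gb g0 gc]; split; first exact: bij_comp.
  by rewrite /= g0.
by move=> v x /=; have [y ->] := gc v x; exact: fc.
Qed.

Lemma is_tree_aut_can f g :
  is_tree_aut f -> cancel f g -> cancel g f -> is_tree_aut g.
Proof.
move=> [fb f0 fc] fK gK; split; first by exists f.
  by rewrite -f0 fK.
move=> v x; have := gK (rcons v x).
case: (lastP (g (rcons v x))) => [|u z].
  by rewrite f0; case: v.
have [y ->] := fc u z => /rcons_inj [<- _].
by exists z; rewrite fK.
Qed.

Lemma tree_aut_inv (g : tree_aut) :
  {h : vertex -> vertex | cancel g h & cancel h g}.
Proof.
suff /cid2[h gh hg] : exists2 h, cancel g h & cancel h g by exists h.
by have [[h gh hg] _ _] := tree_autP g; exists h.
Qed.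

Definition aut_one : tree_aut := mk_aut is_tree_aut_id.

Definition aut_mul (g h : tree_aut) : tree_aut :=
  mk_aut (is_tree_aut_comp (tree_autP g) (tree_autP h)).

Definition aut_inv (g : tree_aut) : tree_aut :=
  let: exist2 _ gK hK := tree_aut_inv g in
  mk_aut (is_tree_aut_can (tree_autP g) gK hK).

Lemma aut_mulA : associative aut_mul.
Proof. by move=> f g h; apply: tree_aut_ext. Qed.

Lemma aut_mul1 : left_id aut_one aut_mul.
Proof. by move=> g; apply: tree_aut_ext. Qed.

Lemma aut_mulr1 : right_id aut_one aut_mul.
Proof. by move=> g; apply: tree_aut_ext. Qed.

Lemma aut_mulV : left_inverse aut_one aut_inv aut_mul.
Proof.
move=> g; apply: tree_aut_ext => v; rewrite /aut_inv.
by case: (tree_aut_inv g) => h gK hK; exact: gK.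
Qed.

Lemma aut_mulrV : right_inverse aut_one aut_inv aut_mul.
Proof.
move=> g; apply: tree_aut_ext => v; rewrite /aut_inv.
by case: (tree_aut_inv g) => h gK hK; exact: hK.
Qed.

HB.instance Definition _ := isGroup.Build tree_aut
  aut_mulA aut_mul1 aut_mulr1 aut_mulV aut_mulrV.

(* The map of the tree that acts as P at the vertices [v] with [p v = true]
   and as I at the others: the letter following the prefix [v] is switched
   exactly when [p v]. *)
Fixpoint act (p : vertex -> bool) (w : vertex) : vertex :=
  if w is x :: w' then (x (+) p [::]) :: act (fun v => p (x :: v)) w'
  else [::].

Fixpoint inv_act (p : vertex -> bool) (w : vertex) : vertex :=
  if w is y :: w' then
    let x := y (+) p [::] in x :: inv_act (fun v => p (x :: v)) w'
  else [::].

Lemma is_tree_aut_act p : is_tree_aut (act p).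
Proof.
split=> //; last first.
  move=> v; elim: v p => [|z v IH] p x /=; first by exists (x (+) p [::]).
  by have [y ->] := IH (fun v => p (z :: v)) x; exists y.
exists (inv_act p) => w; elim: w p => [//|x w IH] p /=.
- by rewrite -addbA addbb addbF IH.
- by rewrite IH -addbA addbb addbF.
Qed.

Definition aut_of_action (p : vertex -> bool) : tree_aut :=
  mk_aut (is_tree_aut_act p).

(* Sequences over {P, I} are indexed from 0, with [true] for P: the term a_n is
   [s n.-1], so [s n] is the action at the vertex 1^n 0. *)
Definition aut_of_seq (s : nat -> bool) : tree_aut :=
  aut_of_action (fun v =>
    let n := (size v).-1 in (v == rcons (nseq n true) false) && s n).

Definition aut_a : tree_aut := aut_of_action (fun v => v == [::]).
Definition aut_x : tree_aut := aut_of_seq (fun=> true).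

(* The letter omega_n is [omega n.-1]. *)
Section Overgroup.
Variable omega : nat -> 'I_3.

Definition aut_b : tree_aut := aut_of_seq (fun n => omega n != 2 :> nat).
Definition aut_c : tree_aut := aut_of_seq (fun n => omega n != 1 :> nat).
Definition aut_d : tree_aut := aut_of_seq (fun n => omega n != 0 :> nat).

End Overgroup.

Definition eventually_constant (T : Type) (u : nat -> T) : Prop :=
  exists (c : T) (N : nat), forall n, (N <= n)%N -> u n = c.

Section Growth.
Local Open Scope group_scope.
Variable gT : groupType.

Definition subgroup (H : set gT) : Prop :=
  H 1 /\ forall g h, H g -> H h -> H (g * h^-1).

Definition generated (S : set gT) : set gT := smallest subgroup S.

(* The elements of length at most [n]; as usual, a generator may be used with
   exponent 1 or -1. *)
Definition word_ball (S : set gT) (n : nat) : set gT :=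
  [set g | exists w : seq gT,
     [/\ (size w <= n)%N, forall s, s \in w -> S s \/ S s^-1
       & g = \prod_(s <- w) s]].

Lemma finite_word_ball (S : set gT) n :
  finite_set S -> finite_set (word_ball S n).
Proof.
move=> fS.
pose T := S `|` [set s | S s^-1%g].
have fT : finite_set T.
  rewrite finite_setU; split=> //.
  apply: (@sub_finite_set _ _ ((fun s : gT => s^-1%g) @` S)).
    by move=> s Ss; exists s^-1%g => //; rewrite invgK.
  exact: finite_image.
elim: n => [|n IH].
  apply: (@sub_finite_set _ _ [set 1%g]); last exact: finite_set1.
  by move=> g [[|s w] [// _ _ ->]]; rewrite big_nil.
apply: (@sub_finite_set _ _
  ([set 1%g] `|` [set (s * h)%g | s in T & h in word_ball S n])).
  move=> g [[|s w] [sw hw ->]]; first by left; rewrite big_nil.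
  right; exists s; first by have := hw s (mem_head _ _).
  exists (\prod_(t <- w) t)%g; last by rewrite big_cons.
  exists w; split=> // t tw; apply: hw.
  by rewrite in_cons tw orbT.
rewrite finite_setU; split; first exact: finite_set1.
exact: finite_image2.
Qed.

(* [fset_set] is only meaningful on finite sets, hence the lemma above. *)
Definition growth (S : set gT) (n : nat) : nat :=
  #|` fset_set (word_ball S n)|.

Definition finite_generating_set (G S : set gT) : Prop :=
  finite_set S /\ generated S = G.

Variable R : realType.
Local Open Scope ring_scope.

(* Neither growth property depends on the choice of [S]; the negations in
   [intermediate_growth] thus exclude every finite generating set. *)
Definition polynomial_growth (G : set gT) : Prop :=
  exists2 S, finite_generating_set G S &
  exists p : {poly R}, forall n, (growth S n)%:R <= p.[n%:R].

Definition exponential_growth (G : set gT) : Prop :=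
  exists2 S, finite_generating_set G S &
  exists2 l : R, 1 < l &
    ((growth S n)%:R `^ (n%:R^-1) : R) @[n --> \oo] --> l.

Definition intermediate_growth (G : set gT) : Prop :=
  [/\ exists S, finite_generating_set G S,
      ~ polynomial_growth G & ~ exponential_growth G].

End Growth.

Definition overgroup (omega : nat -> 'I_3) : set tree_aut :=
  generated
    [set` [:: aut_a; aut_b omega; aut_c omega; aut_d omega; aut_x]].

(* Main.v *)
(* Upper bound. A letter y of the alphabet {0,1,2} -> {I,P} denotes the
   automorphism of the sequence y(omega_n); a word is a product of such letters
   and of a. In a reduced word the letters alternate with a; each letter passes
   to one of the two sections and contributes an a to the other one when its
   first term is P. Let a have weight 1, and let a letter have weight 2 if its
   first m terms are all P and weight 1 otherwise. Then passing to the sections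
   and from m + 1 to m increases the total weight by at most 1, hence the sum of
   exp (- s * weight) over the group of omega is at most 2 exp(s) times the
   square of the sum over the group of the shift of omega. For m = 0 every letter
   has weight 2, while for m large every letter other than x has weight 1.
   Alternating words with few letters other than x are few, so that the sums of
   the unweighted length converge at (1 - d) s for all omega if they converge at
   s for all omega, with d uniform as long as (1 - d) s >= s0; iterating, they
   converge for every s > 0. This argument does not depend on omega.

   Lower bound. If i = omega_1 is not the value of omega from some point on, then
   modulo the normal subgroup {g | (1, g) in G_omega} of the group of the shift,
   x is congruent to the letter which is P exactly at i, whose product with a has
   finite order. The quotient is thus a finite dihedral group, so that some
   power of every element of the group of the shift can be inserted in either
   subtree. Starting from x a, which has infinite order, this produces for every
   k elements g_1, .., g_{2^k} such that the products of their powers are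
   pairwise distinct.

   If omega is eventually constant, iterated sections reduce the count to the
   infinite dihedral group generated by a and x. *)
Require Import Defs.
From mathcomp Require Import all_boot all_order all_algebra finmap.
From mathcomp Require Import all_classical all_reals all_analysis.
From mathcomp Require Import zify ring lra.

Set Implicit Arguments.
Unset Strict Implicit.
Unset Printing Implicit Defensive.

Import Order.TTheory GRing.Theory Num.Theory.

(** * Wreath recursion *)

Section Wreath.
Local Open Scope group_scope.

(** Sections are indexed by the first letter before the switch; hence in [brM] the sections of the
    left factor are exchanged when the right factor switches. *)
Definition br_fun (e : bool) (g0 g1 : tree_aut) (v : vertex) : vertex :=
  if v is x :: v' then (x (+) e) :: (if x then g1 else g0) v' else [::].

Lemma br_subproof e g0 g1 : is_tree_aut (br_fun e g0 g1).
Proof.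
split=> //; last first.
  case=> [|y v] x /=.
    by exists (x (+) e); have [_ -> _] := tree_autP (if x then g1 else g0).
  have [_ _ /(_ v x)] := tree_autP (if y then g1 else g0).
  by case: y => -[z ->]; exists z.
have [h0 h0K h0K'] := tree_aut_inv g0; have [h1 h1K h1K'] := tree_aut_inv g1.
exists (fun v => if v is x :: v' then
  (x (+) e) :: (if x (+) e then h1 else h0) v' else [::]).
  by case=> //= x v; rewrite -addbA addbb addbF; case: x; rewrite ?h0K ?h1K.
case=> //= x v; rewrite -addbA addbb addbF.
by case: (x (+) e); rewrite ?h0K' ?h1K'.
Qed.

Definition br e g0 g1 : tree_aut := mk_aut (br_subproof e g0 g1).

Lemma brE e g0 g1 x v :
  br e g0 g1 (x :: v) = (x (+) e) :: (if x then g1 else g0) v.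
Proof. by []. Qed.

Lemma actE p v : aut_of_action p v = act p v.
Proof. by []. Qed.

Lemma mulE (g h : tree_aut) v : (g * h : tree_aut) v = g (h v).
Proof. by []. Qed.

Lemma oneE v : (1 : tree_aut) v = v.
Proof. by []. Qed.

Lemma br_nil e g0 g1 : br e g0 g1 [::] = [::].
Proof. by []. Qed.

Lemma brM e g0 g1 f h0 h1 :
  br e g0 g1 * br f h0 h1 =
  br (e (+) f) ((if f then g1 else g0) * h0) ((if f then g0 else g1) * h1).
Proof.
apply: tree_aut_ext => -[|x v]; rewrite mulE ?br_nil // !brE.
by move: f e x => [] [] [].
Qed.

Lemma br1 : br false 1 1 = 1.
Proof. by apply: tree_aut_ext => -[|[] v]. Qed.

Lemma br_inj e g0 g1 f h0 h1 : br e g0 g1 = br f h0 h1 ->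
  [/\ e = f, g0 = h0 & g1 = h1].
Proof.
move=> E.
have H v : br_fun e g0 g1 v = br_fun f h0 h1 v.
  by move: (congr1 (fun g : tree_aut => g v) E).
split; first by move: (H [:: false]) => /= [].
- by apply: tree_aut_ext => v; move: (H (false :: v)) => /= [].
- by apply: tree_aut_ext => v; move: (H (true :: v)) => /= [].
Qed.

Lemma act_ext p q : p =1 q -> act p =1 act q.
Proof.
move=> pq v; elim: v p q pq => //= x v IH p q pq.
by rewrite pq (IH _ _ (fun v => pq (x :: v))).
Qed.

Lemma act_triv v : act (fun=> false) v = v.
Proof. by elim: v => //= x v IH; rewrite addbF IH. Qed.

Lemma aut_aE : aut_a = br true 1 1.
Proof.
apply: tree_aut_ext => -[|x v] //; rewrite brE actE /= act_triv.
by case: x.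
Qed.

Lemma aut_of_seqE s :
  aut_of_seq s =
  br false (if s 0%N then aut_a else 1) (aut_of_seq (fun n => s n.+1)).
Proof.
apply: tree_aut_ext => -[|x v] //; rewrite brE actE; congr (_ :: _).
case: x.
  by rewrite actE; apply: act_ext => -[|y u].
case: (boolP (s 0%N)) => s0; [rewrite actE | rewrite oneE -[RHS]act_triv].
  by apply: act_ext => -[|[] u].
by apply: act_ext => -[|[] u]; rewrite /= ?(negPf s0).
Qed.

Lemma mulaa : aut_a * aut_a = 1.
Proof. by rewrite aut_aE brM /= !mulg1 br1. Qed.

Lemma aut_of_seqM s t :
  aut_of_seq s * aut_of_seq t = aut_of_seq (fun n => s n (+) t n).
Proof.
apply: tree_aut_ext => v; elim: v s t => // x v IH s t.
rewrite [aut_of_seq s]aut_of_seqE [aut_of_seq t]aut_of_seqE brM.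
rewrite [in RHS]aut_of_seqE !brE; congr (_ :: _).
case: x; first exact: IH.
by case: (s _); case: (t _); rewrite ?mulaa ?mulg1 ?mul1g.
Qed.

Lemma aut_of_seq0 : aut_of_seq (fun=> false) = 1.
Proof.
apply: tree_aut_ext => v; elim: v => // x v IH.
by rewrite aut_of_seqE brE addbF; case: x; rewrite // IH.
Qed.

End Wreath.

(** * Words, sections and weights *)

Notation letter := {ffun 'I_3 -> bool}.
Notation word := (seq (option letter)).

Definition shift (omega : nat -> 'I_3) : nat -> 'I_3 := fun n => omega n.+1.

Section Words.
Local Open Scope group_scope.
Implicit Types (omega : nat -> 'I_3) (u : option letter) (w : word).
Implicit Types (y z : letter).

(* All the sequences of the paper depend on n through omega_n only, so that a
   function of {0, 1, 2} serves as a letter for every omega at once; in a word,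
   [None] stands for a. *)
Definition let_aut omega (y : letter) : tree_aut :=
  aut_of_seq (fun n => y (omega n)).

Definition gen omega u := if u is Some y then let_aut omega y else aut_a.

Definition ev omega w : tree_aut := \prod_(u <- w) gen omega u.

Fixpoint par w := if w is u :: w' then (u == None) (+) par w' else false.

(** The last symbol of a word acts first, so the first letter of the vertex has become
    [x (+) par w'] when [u] acts. At 1 the letter [u] is passed on unchanged, to be read along the
    shift; at 0 only its first term is left. *)
Fixpoint sec omega (x : bool) w : word :=
  if w is u :: w' then
    if u is Some y then
      if x (+) par w' then u :: sec omega x w'
      else if y (omega 0%N) then None :: sec omega x w' else sec omega x w'
    else sec omega x w'
  else [::].

Lemma ev_nil omega : ev omega [::] = 1.
Proof. by rewrite /ev big_nil. Qed.

Lemma ev_cons omega u w : ev omega (u :: w) = gen omega u * ev omega w.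
Proof. by rewrite /ev big_cons. Qed.

Lemma ev_cat omega w1 w2 : ev omega (w1 ++ w2) = ev omega w1 * ev omega w2.
Proof. by rewrite /ev big_cat. Qed.

Lemma let_autE omega y : let_aut omega y =
  br false (if y (omega 0%N) then aut_a else 1) (let_aut (shift omega) y).
Proof. exact: aut_of_seqE. Qed.

Lemma let_autM omega y z :
  let_aut omega y * let_aut omega z = let_aut omega [ffun i => y i (+) z i].
Proof.
rewrite /let_aut aut_of_seqM; congr aut_of_seq.
by apply/funext => n; rewrite ffunE.
Qed.

Lemma let_autV omega y : let_aut omega y * let_aut omega y = 1.
Proof.
rewrite /let_aut aut_of_seqM -aut_of_seq0; congr aut_of_seq.
by apply/funext => n; rewrite addbb.
Qed.

Lemma genV omega u : gen omega u * gen omega u = 1.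
Proof. by case: u => [y|]; [exact: let_autV | exact: mulaa]. Qed.

Lemma gen_inv omega u : (gen omega u)^-1 = gen omega u.
Proof. exact: mulg1_eq (genV omega u). Qed.

Lemma ev_rev omega w : ev omega (rev w) = (ev omega w)^-1.
Proof.
elim: w => [|u w IH]; first by rewrite ev_nil invg1.
rewrite rev_cons -cats1 ev_cat IH [ev _ [:: _]]ev_cons ev_nil mulg1.
by rewrite [ev _ (_ :: _)]ev_cons invgM gen_inv.
Qed.

Lemma ev_sec omega w : ev omega w =
  br (par w) (ev (shift omega) (sec omega false w))
             (ev (shift omega) (sec omega true w)).
Proof.
elim: w => [|[y|] w IH]; first by rewrite !ev_nil br1.
  rewrite ev_cons IH /= let_autE brM /=; case: (par w) => /=;
  by case: (y _); rewrite ?ev_cons ?mul1g.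
by rewrite ev_cons IH /= aut_aE brM; case: (par w); rewrite !mul1g.
Qed.

Fixpoint live m omega (y : letter) :=
  if m is m'.+1 then y (omega 0%N) && live m' (shift omega) y else true.

Definition wt m omega u : nat :=
  if u is Some y then (live m omega y).+1 else 1%N.

Definition wtw m omega w : nat := (\sum_(u <- w) wt m omega u)%N.

Fixpoint altb (b : bool) w :=
  if w is u :: w' then (isSome u == b) && altb (~~ b) w' else true.

Definition alt w := altb true w || altb false w.

Definition ncons u w : word :=
  match u, w with
  | None, None :: w' => w'
  | Some y, Some z :: w' => Some [ffun i => y i (+) z i] :: w'
  | _, _ => u :: w
  end.

Definition norm w := foldr ncons [::] w.

Lemma wtw_cons m omega u w :
  wtw m omega (u :: w) = (wt m omega u + wtw m omega w)%N.
Proof. by rewrite /wtw big_cons. Qed.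

Lemma alt_ncons u w : alt w -> alt (ncons u w).
Proof.
case: u w => [y|] [|[z|] w] //; rewrite /alt /= ?orbF ?andbT //.
by move=> ->.
Qed.

Lemma alt_norm w : alt (norm w).
Proof. by elim: w => //= u w; exact: alt_ncons. Qed.

Lemma ev_ncons omega u w : ev omega (ncons u w) = gen omega u * ev omega w.
Proof.
case: u w => [y|] [|[z|] w]; rewrite /ncons ?ev_cons //= mulgA.
  by rewrite let_autM.
by rewrite mulaa mul1g.
Qed.

Lemma ev_norm omega w : ev omega (norm w) = ev omega w.
Proof. by elim: w => //= u w IH; rewrite ev_ncons IH ev_cons. Qed.

(** A merged letter weighs at most 2, and the two letters it replaces weigh at least 1 each. *)
Lemma wtw_ncons m omega u w :
  (wtw m omega (ncons u w) <= wt m omega u + wtw m omega w)%N.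
Proof.
case: u w => [y|] [|[z|] w]; rewrite /ncons ?wtw_cons //=; last by lia.
by case: (live _ _ _); case: (live _ _ _); case: (live _ _ _); lia.
Qed.

Lemma wtw_norm m omega w : (wtw m omega (norm w) <= wtw m omega w)%N.
Proof.
elim: w => //= u w IH; rewrite wtw_cons.
by apply: leq_trans (wtw_ncons _ _ _ _) _; rewrite leq_add2l.
Qed.

Lemma altb_count b w : altb b w ->
  (count isSome w <= count (fun u => ~~ isSome u) w + b)%N.
Proof.
elim: w b => //= u w IH b /andP[/eqP <- /IH]; case: u => /=; lia.
Qed.

(** Every a disappears. A letter with first term P keeps its weight and adds an a of weight 1; one
    with first term I weighs 1 for [m.+1], at most 2 in its section, and adds nothing. So a letter
    gains at most 1, and in an alternating word the lost a's make up for all gains but one. *)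
Lemma sec_wtw m omega w :
  (wtw m (shift omega) (sec omega false w) +
   wtw m (shift omega) (sec omega true w) + count (fun u => ~~ isSome u) w
   <= wtw m.+1 omega w + count isSome w)%N.
Proof.
elim: w => [|u w IH]; first by rewrite /wtw !big_nil.
rewrite [wtw m.+1 _ (_ :: _)]wtw_cons; case: u => [y|] /=; last by lia.
by case: (par w) => /=; case: (y _); rewrite /= ?wtw_cons /=;
  case: (live m _ _); move: IH; lia.
Qed.

Lemma sec_wtw_alt m omega w : alt w ->
  (wtw m (shift omega) (sec omega false w) +
   wtw m (shift omega) (sec omega true w) <= wtw m.+1 omega w + 1)%N.
Proof.
by move=> /orP[] /altb_count; have := sec_wtw m omega w; lia.
Qed.

End Words.

(** * Exponential sums over the group *)

Section Sums.
Local Open Scope ring_scope.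
Variable R : realType.
Implicit Types (omega : nat -> 'I_3) (u : option letter) (w : word).
Implicit Types (y z : letter).

Lemma ler_sum_sub (T : eqType) (s t : seq T) (F : T -> R) :
  uniq s -> {subset s <= t} -> (forall x, 0 <= F x) ->
  \sum_(x <- s) F x <= \sum_(x <- t) F x.
Proof.
move=> us st F0; elim: s t us st => [|x s IH] t /=.
  by rewrite big_nil sumr_ge0.
move=> /andP[xs us] st; rewrite big_cons [leRHS](big_rem x) ?st ?mem_head //=.
rewrite lerD2l; apply: IH => // z zs.
have : z \in t by apply: st; rewrite inE zs orbT.
rewrite (perm_mem (perm_to_rem (st x (mem_head _ _)))) inE.
by case: eqP => // zx _; rewrite -zx zs in xs.
Qed.

Fixpoint alts (b : bool) (n : nat) : seq word :=
  if n is n'.+1 then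
    [seq u :: w | u <- (if b then map Some (enum {: letter}) else [:: None]),
                  w <- alts (~~ b) n']
  else [:: [::]].

Lemma mem_alts b w : altb b w -> w \in alts b (size w).
Proof.
elim: w b => //= u w IH b /andP[ub /IH wb].
apply/allpairsP; exists (u, w); split=> //=.
case: u b ub {wb} => [y|] [] // _.
by apply: map_f; rewrite mem_enum.
Qed.

Lemma sum_alts (f : option letter -> R) (rho : R) b n :
  (forall u, 0 <= f u) -> f None <= rho -> \sum_y f (Some y) <= rho ->
  \sum_(w <- alts b n) \prod_(u <- w) f u <= rho ^+ n.
Proof.
move=> f0 fN fS; elim: n b => [|n IH] b /=.
  by rewrite big_seq1 big_nil expr0.
rewrite big_allpairs_dep /= exprS.
have g0 w : 0 <= \prod_(u <- w) f u by apply: prodr_ge0.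
under eq_bigr do under eq_bigr do rewrite big_cons.
under eq_bigr do rewrite -mulr_sumr.
rewrite -mulr_suml; apply: ler_pM => //.
- by apply: sumr_ge0.
- by apply: sumr_ge0.
- by case: b; rewrite ?big_seq1 // big_map big_enum.
Qed.

(** A geometric series in the length, once for each of the two kinds of first symbol. *)
Lemma sum_alt (f : option letter -> R) (rho : R) (ws : seq word) :
  (forall u, 0 <= f u) -> f None <= rho -> \sum_y f (Some y) <= rho ->
  rho < 1 -> uniq ws -> all alt ws ->
  \sum_(w <- ws) \prod_(u <- w) f u <= 2 / (1 - rho).
Proof.
move=> f0 fN fS rho1 uws aws.
have rho0 : 0 <= rho by apply: le_trans fN.
have g0 w : 0 <= \prod_(u <- w) f u by apply: prodr_ge0.
pose N := (\max_(w <- ws) size w).+1.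
pose L b := flatten [seq alts b n | n <- iota 0 N].
pose t := [seq w | b <- [:: true; false], w <- L b].
apply: (@le_trans _ _ (\sum_(w <- t) \prod_(u <- w) f u)).
  apply: ler_sum_sub => // w ww.
  have wN : size w \in iota 0 N.
    by rewrite mem_iota /= add0n ltnS (leq_bigmax_seq _ ww).
  have /orP wa := allP aws w ww.
  have [b wb] : exists b, altb b w by case: wa; [exists true | exists false].
  apply/allpairsPdep; exists b, w; split=> //; first by case: (b).
  by apply/flattenP; exists (alts b (size w)); [apply: map_f | exact: mem_alts].
have H b : \sum_(w <- L b) \prod_(u <- w) f u <= (1 - rho)^-1.
  rewrite big_flatten big_map.
  apply: (@le_trans _ _ (\sum_(n <- iota 0 N) rho ^+ n)).
    by apply: ler_sum => n _; exact: sum_alts.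
  have -> : \sum_(n <- iota 0 N) rho ^+ n = \sum_(i < N) rho ^+ i.
    by rewrite -(big_mkord xpredT (fun i => rho ^+ i)) /index_iota subn0.
  rewrite -[leRHS]mulr1 -ler_pdivrMl ?invrK ?invr_gt0 ?subr_gt0 //.
  have := subrX1 rho N; rewrite -opprB -[X in _ = X * _]opprB mulNr.
  move=> /oppr_inj <-; rewrite gerBl exprn_ge0 //.
rewrite big_allpairs_dep /= big_cons big_seq1.
by rewrite mulr_natl mulr2n; apply: lerD.
Qed.

Lemma expR_wtw m omega (s : R) w :
  expR (- (s * (wtw m omega w)%:R)) =
  \prod_(u <- w) expR (- (s * (wt m omega u)%:R)).
Proof.
elim: w => [|u w IH]; first by rewrite /wtw !big_nil mulr0 oppr0 expR0.
by rewrite wtw_cons big_cons -IH -expRD natrD mulrDr opprD.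
Qed.

(** Convergence of the sum over the group, stated through its finite partial sums: a list of words
    with distinct values is a finite set of elements with arbitrary representatives. *)
Definition exp_summable m omega (s : R) : Prop :=
  exists C : R, forall ws : seq word,
  uniq (map (ev omega) ws) ->
  \sum_(w <- ws) expR (- (s * (wtw m omega w)%:R)) <= C.

Lemma exp_summable_alt m omega (s : R) : 0 <= s ->
  (exists C : R, forall ws : seq word, uniq (map (ev omega) ws) -> all alt ws ->
  \sum_(w <- ws) expR (- (s * (wtw m omega w)%:R)) <= C) -> exp_summable m omega s.
Proof.
move=> s0 [C HC]; exists C => ws uws.
apply: le_trans (HC (map norm ws) _ _).
- rewrite big_map; apply: ler_sum => w _.
  by rewrite ler_expR lerN2 ler_wpM2l // ler_nat wtw_norm.
- by rewrite -map_comp (eq_map (ev_norm omega)).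
- by apply/allP => _ /mapP[w _ ->]; exact: alt_norm.
Qed.

(** For m = 0 each of the 8 letters has weight 2, and 8 exp (- 16) <= exp (- 8). *)
Lemma exp_summable8 omega : exp_summable 0 omega 8.
Proof.
apply: exp_summable_alt => //; exists (2 / (1 - expR (- 8))) => ws uws aws.
under eq_bigr do rewrite expR_wtw.
apply: sum_alt (map_uniq uws) aws.
- by move=> u; exact: expR_ge0.
- by rewrite mulr1.
- rewrite /= sumr_const card_ffun card_bool card_ord.
  have -> : - (8 * 2) = - 8 - 8 :> R by ring.
  rewrite expRD -[leRHS]mulr1 -mulrnAr ler_pM2l ?expR_gt0 //.
  rewrite expRN -mulr_natl ler_pdivrMr ?expR_gt0 // mul1r.
  apply: le_trans (expR_ge1Dx _); rewrite -natr1 addrC lerD2l.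
  by lra.
- by rewrite expRN invf_lt1 ?expR_gt0 // expR_gt1.
Qed.

Lemma exp_summable_le m omega (s s' : R) : s <= s' -> exp_summable m omega s ->
  exp_summable m omega s'.
Proof.
move=> ss' [C HC]; exists C => ws uws; apply: le_trans (HC ws uws).
by apply: ler_sum => w _; rewrite ler_expR lerN2 ler_wpM2r.
Qed.

(** Representatives of minimal weight turn sums over words into sums over elements. Outside the
    group [r] takes the default value [[::]]. *)
Lemma min_word m omega : exists r : tree_aut -> word, forall w,
  ev omega (r (ev omega w)) = ev omega w /\
  (wtw m omega (r (ev omega w)) <= wtw m omega w)%N.
Proof.
suff /choice [r Hr] : forall g, exists r, forall w, ev omega w = g ->
    ev omega r = g /\ (wtw m omega r <= wtw m omega w)%N.
  by exists r => w; exact: Hr.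
move=> g; have [[w0 w0g]|ng] := pselect (exists w, ev omega w = g); last first.
  by exists [::] => w wg; case: ng; exists w.
have ex : exists n, `[< exists2 w, ev omega w = g & wtw m omega w = n >].
  by exists (wtw m omega w0); apply/asboolP; exists w0.
case: (ex_minnP ex) => n /asboolP[r rg rn] min; exists r => w wg; split=> //.
by rewrite rn; apply: min; apply/asboolP; exists w.
Qed.

Lemma exp_summableS m omega (s : R) : 0 <= s ->
  exp_summable m (shift omega) s -> exp_summable m.+1 omega s.
Proof.
move=> s0 [C HC]; have [r Hr] := min_word m (shift omega).
pose f g := expR (- (s * (wtw m (shift omega) (r g))%:R)).
pose h x w := ev (shift omega) (sec omega x w).
have f0 g : 0 <= f g by exact: expR_ge0.
apply: exp_summable_alt => //; exists (expR s * (2 * (C * C))) => ws uws aws.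
have HU x : \sum_(g <- undup (map (h x) ws)) f g <= C.
  have := HC (map r (undup (map (h x) ws))); rewrite big_map; apply.
  rewrite -map_comp map_id_in ?undup_uniq // => g.
  by rewrite mem_undup => /mapP[w _ ->]; have [] := Hr (sec omega x w).
pose T w := (par w, (h false w, h true w)).
pose U := [seq (b, p) | b <- [:: false; true], p <-
  [seq (g0, g1) | g0 <- undup (map (h false) ws),
                  g1 <- undup (map (h true) ws)]].
apply: (@le_trans _ _ (expR s * \sum_(p <- map T ws) (f p.2.1 * f p.2.2))).
  rewrite big_map mulr_sumr big_seq [leRHS]big_seq; apply: ler_sum => w ww /=.
  rewrite -!expRD ler_expR.
  have [_ H0] := Hr (sec omega false w); have [_ H1] := Hr (sec omega true w).
  have := sec_wtw_alt m omega (allP aws w ww).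
  move=> /(leq_trans (leq_add H0 H1)); rewrite -/(h _ _) -/(h _ _).
  rewrite -(ler_nat R) !natrD => /(ler_wpM2l s0); rewrite !mulrDr mulr1; lra.
rewrite ler_pM2l ?expR_gt0 //.
apply: (@le_trans _ _ (\sum_(p <- U) (f p.2.1 * f p.2.2))).
  apply: ler_sum_sub => [| p /mapP[w ww ->] | p]; last by rewrite mulr_ge0.
    (* By [ev_sec] an element is recovered from its parity and its two sections, so distinct
       elements give distinct triples. *)
    move: uws; rewrite -(map_inj_uniq (f := id)) // -map_comp.
    pose k (p : bool * (tree_aut * tree_aut)) := br p.1 p.2.1 p.2.2.
    have -> : map (id \o ev omega) ws = map k (map T ws).
      by rewrite -map_comp; apply: eq_map => w; rewrite /= ev_sec.
    exact: map_uniq.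
  apply/allpairsPdep; exists (par w), (h false w, h true w); split=> //.
    by case: (par w).
  apply/allpairsPdep; exists (h false w), (h true w).
  by rewrite !mem_undup !map_f.
rewrite big_allpairs_dep /= !big_cons big_nil /= addr0 mulr_natl mulr2n.
suff H : \sum_(p <- [seq (g0, g1) | g0 <- undup (map (h false) ws),
   g1 <- undup (map (h true) ws)]) f p.1 * f p.2 <= C * C by apply: lerD.
rewrite big_allpairs_dep /=; under eq_bigr do rewrite -mulr_sumr.
by rewrite -mulr_suml; apply: ler_pM => //; apply: sumr_ge0.
Qed.

Lemma exp_summable_weights (s : R) : 0 <= s ->
  (forall omega, exp_summable 0 omega s) ->
  forall m omega, exp_summable m omega s.
Proof. by move=> s0 H; elim=> // m IH omega; exact: exp_summableS. Qed.

End Sums.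

(** * Contraction of the exponent, down to every positive value *)

Section Contraction.
Local Open Scope ring_scope.
Variable R : realType.
Implicit Types (omega : nat -> 'I_3) (u : option letter) (w : word).
Implicit Types (y z : letter).

Lemma liveP m omega y :
  reflect (forall n, (n < m)%N -> y (omega n)) (live m omega y).
Proof.
elim: m omega => [|m IH] omega /=; first by constructor.
apply: (iffP andP) => [[y0 /IH H] [|n]|H] //; first exact: H.
by split; [exact: H | apply/IH => n; apply: (H n.+1)].
Qed.

(** There are finitely many letters, so one [m] detects all those that act as x. It depends on
    [omega], which is harmless because [exp_summable_weights] covers every [m]. *)
Lemma live_stable omega :
  exists m, forall y, live m omega y -> forall n, y (omega n).
Proof.
have /choice [k Hk] : forall y : letter,
    exists m, live m omega y -> forall n, y (omega n).
  move=> y; have [H|/existsNP [n Hn]] := pselect (forall n, y (omega n)).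
    by exists 0%N.
  by exists n.+1 => /liveP /(_ n (ltnSn n)).
exists (\max_y k y)%N => y /liveP H; apply: (Hk y); apply/liveP => n nk.
by apply: H; apply: leq_trans nk (leq_bigmax _).
Qed.

Definition x_letter : letter := [ffun=> true].

(** Several letters may act as x for a given [omega]; keeping a single one makes words with few dead
    letters few. *)
Definition canon m omega u : option letter :=
  if u is Some y then Some (if live m omega y then x_letter else y) else None.

Definition dead m omega u : nat :=
  if u is Some y then ~~ live m omega y else 0%N.

Lemma wt_dead m omega u : (wt m omega u + dead m omega u = wt 0 omega u)%N.
Proof. by case: u => //= y; case: (live _ _ _). Qed.

Lemma wtw_dead m omega w :
  (wtw m omega w + \sum_(u <- w) dead m omega u = wtw 0 omega w)%N.
Proof.
by rewrite /wtw -big_split /=; apply: eq_bigr => u _; exact: wt_dead.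
Qed.

Lemma live_x m omega : live m omega x_letter.
Proof. by apply/liveP => n _; rewrite ffunE. Qed.

Lemma ev_canon m omega w :
  (forall y, live m omega y -> forall n, y (omega n)) ->
  ev omega (map (canon m omega) w) = ev omega w.
Proof.
move=> Hm; rewrite /ev big_map; apply: eq_bigr => -[y|] _ //=.
case: ifP => // /Hm yT; rewrite /let_aut; congr aut_of_seq.
by apply/funext => n; rewrite ffunE yT.
Qed.

Lemma wtw_canon m omega w : wtw 0 omega (map (canon m omega) w) = wtw 0 omega w.
Proof. by rewrite /wtw big_map; apply: eq_bigr => -[y|]. Qed.

Lemma alt_canon m omega w : alt (map (canon m omega) w) = alt w.
Proof.
suff H b : altb b (map (canon m omega) w) = altb b w by rewrite /alt !H.
by elim: w b => //= -[y|] w IH b; rewrite /= IH.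
Qed.

Lemma contraction (s0 : R) : 0 < s0 -> s0 <= 1 -> exists2 d : R, 0 < d < 1 &
  forall m omega (s : R), (forall y, live m omega y -> forall n, y (omega n)) ->
  exp_summable m omega s -> s0 <= (1 - d) * s ->
  exp_summable 0 omega ((1 - d) * s).
Proof.
(* [t] is such that 8 exp (- t) <= 8 / t = s0 / 2, and [d] such that t d = s0 / 2. Neither depends
   on [omega], [m] or [s]. *)
move=> s0_gt0 s0_le1; pose t := 16 / s0.
have t_gt0 : 0 < t by rewrite divr_gt0.
have ts0 : t * s0 = 16 by rewrite /t mulfVK // gt_eqF.
have t16 : 16 <= t by rewrite -ts0 ler_piMr // ltW.
pose d := s0 / (2 * t).
have td : t * d = s0 / 2 by rewrite /d; field; rewrite gt_eqF.
have d_gt0 : 0 < d by rewrite divr_gt0 // mulr_gt0.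
have d_lt1 : d < 1 by rewrite /d ltr_pdivrMr; [lra | rewrite mulr_gt0].
exists d; first by rewrite d_gt0.
move=> m omega s Hm [C HC] s0s.
have s_ge0 : 0 <= s.
  by rewrite -(pmulr_rge0 _ (_ : 0 < 1 - d)) ?subr_gt0 //; lra.
(* A word with c = wt 0 and b letters other than x, where b < d c, has
   exp (- s0 c) <= exp (- s0 c + t (d c - b)) = \prod_(u <- w) f u; the factor
   exp (- t) per such letter makes the sum over alternating words converge
   because 1 + 8 exp (- t) <= 1 + s0 / 2 <= exp (s0 / 2). *)
pose f u : R := if canon m omega u == u
  then expR (- (s0 / 2 * (wt 0 omega u)%:R + t * (dead m omega u)%:R)) else 0.
have f_ge0 u : 0 <= f u by rewrite /f; case: ifP => // _; exact: expR_ge0.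
apply: exp_summable_alt => [|]; first by apply: le_trans s0s; exact: ltW.
exists (C + 2 / (1 - expR (- (s0 / 2)))) => ws uws aws.
pose cs := map (map (canon m omega)) ws.
have ucs : uniq (map (ev omega) cs).
  by rewrite -map_comp (eq_map (fun w => ev_canon w Hm)).
have acs : all alt cs.
  by apply/allP => _ /mapP[w ww ->]; rewrite alt_canon; exact: (allP aws).
have -> : \sum_(w <- ws) expR (- ((1 - d) * s * (wtw 0 omega w)%:R)) =
          \sum_(w <- cs) expR (- ((1 - d) * s * (wtw 0 omega w)%:R)).
  by rewrite big_map; apply: eq_bigr => w _; rewrite wtw_canon.
apply: (@le_trans _ _ (\sum_(w <- cs)
    (expR (- (s * (wtw m omega w)%:R)) + \prod_(u <- w) f u))).
  rewrite big_seq [leRHS]big_seq; apply: ler_sum => _ /mapP[w _ ->].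
  set v := map _ w.
  have -> : \prod_(u <- v) f u = expR (- (s0 / 2 * (wtw 0 omega v)%:R +
     t * (\sum_(u <- v) dead m omega u)%:R)).
    rewrite /v /wtw !big_map /f; elim: w {v} => [|u w IH].
      by rewrite !big_nil !mulr0 addr0 oppr0 expR0.
    rewrite !big_cons IH.
    have -> : canon m omega (canon m omega u) = canon m omega u.
      by case: u => //= y; case ly: (live m omega y); rewrite ?live_x ?ly.
    rewrite eqxx -expRD; congr expR; rewrite !natrD; ring.
  have := wtw_dead m omega v.
  move: (wtw m omega v) (\sum_(u <- v) _)%N (wtw 0 omega v) => a b c /esym abc.
  have {}abc : c%:R = a%:R + b%:R :> R by rewrite abc natrD.
  have c0 : 0 <= c%:R :> R by [].
  (* With many dead letters, a <= (1 - d) c, and the term is bounded by that of the convergent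
     weighted sum. With few, s0 <= (1 - d) s bounds it by the product of the [f u]. *)
  have [bd|bd] := leP (d * c%:R) (b%:R : R).
    apply: (@le_trans _ _ (expR (- (s * a%:R)))); last first.
      by rewrite lerDl expR_ge0.
    by rewrite ler_expR lerN2 [(1 - d) * s]mulrC -mulrA ler_wpM2l //; lra.
  apply: ler_wpDl; first exact: expR_ge0.
  rewrite ler_expR lerN2.
  apply: (@le_trans _ _ (s0 * c%:R)); last by rewrite ler_wpM2r.
  have := ler_wpM2l (ltW t_gt0) (ltW bd); rewrite mulrA td; lra.
rewrite big_split /=; apply: lerD; first exact: HC.
apply: sum_alt (map_uniq ucs) acs => //.
- by rewrite /f eqxx /= mulr1 mulr0 addr0.
- apply: (@le_trans _ _ (\sum_(y : letter)
    (expR (- s0) * ((y == x_letter)%:R + expR (- t))))).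
    apply: ler_sum => y _; rewrite /f /=; case: ifP => [cy|_]; last first.
      by rewrite mulr_ge0 ?addr_ge0 ?expR_ge0.
    have -> : s0 / 2 * 2 = s0 by field.
    have [->|yx] := eqVneq y x_letter.
      rewrite live_x mulr0 addr0 -[leLHS]mulr1 ler_wpM2l ?expR_ge0 //.
      by rewrite lerDl expR_ge0.
    move: cy; case: (live _ _ _) => [/eqP[yx']|_].
      by rewrite -yx' eqxx in yx.
    by rewrite mulr1 add0r opprD expRD.
  rewrite -mulr_sumr big_split /= (bigD1 x_letter) //= eqxx big1 ?addr0;
    last by move=> y /negPf ->.
  rewrite sumr_const card_ffun card_bool card_ord.
  have -> : - (s0 / 2) = - s0 + s0 / 2 by field.
  rewrite expRD ler_wpM2l ?expR_ge0 //.
  apply: le_trans (expR_ge1Dx _); rewrite lerD2l expRN.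
  have tE : t <= expR t by apply: le_trans (expR_ge1Dx _); lra.
  have : (expR t)^-1 <= t^-1 by rewrite lef_pV2 ?posrE ?expR_gt0.
  have -> : t^-1 = s0 / 16 by rewrite /t invf_div.
  rewrite -mulr_natl; lra.
- by rewrite expRN invf_lt1 ?expR_gt0 // expR_gt1 divr_gt0.
Qed.

Lemma exp_summable_all (s0 : R) omega : 0 < s0 -> exp_summable 0 omega s0.
Proof.
wlog s0_le1 : s0 / s0 <= 1.
  move=> H s0_gt0; apply: (@exp_summable_le R _ _ (Num.min s0 1)).
    by rewrite ge_min lexx.
  by apply: H; rewrite ?ge_min ?lexx ?orbT // lt_min s0_gt0 ltr01.
move=> s0_gt0; have [d /andP[d_gt0 d_lt1] Hd] := contraction s0_gt0 s0_le1.
have d'_gt0 : 0 < 1 - d by rewrite subr_gt0.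
(* The maximum with [s0] keeps every iterate in the range where [d] is valid. The induction runs
   over all sequences at once, since the weighted sums for one of them use its shifts. *)
have H j omega' : exp_summable 0 omega' (Num.max s0 ((1 - d) ^+ j * 8)).
  elim: j omega' => [|j IH] omega'.
    apply: exp_summable_le (exp_summable8 _ _).
    by rewrite le_max expr0 mul1r lexx orbT.
  set M := Num.max _ _.
  have -> : M = (1 - d) * (M / (1 - d)) by field; rewrite gt_eqF.
  have [m Hm] := live_stable omega'.
  have M_ge : s0 <= M by rewrite le_max lexx.
  apply: Hd Hm _ _; last by rewrite mulrC mulfVK // gt_eqF.
  apply: exp_summable_weights.
    by rewrite divr_ge0 ?(ltW d'_gt0) //; apply: le_trans M_ge; exact: ltW.
  move=> omega''; apply: exp_summable_le (IH _).
  rewrite ge_max; apply/andP; split; rewrite ler_pdivlMr //.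
    by apply: le_trans M_ge; rewrite ler_piMr ?(ltW s0_gt0) //; lra.
  by rewrite mulrAC -exprSr le_max lexx orbT.
(* (1 - d)^n <= exp (- n d) <= 1 / (n d), so any n >= 8 / (d s0) will do. *)
have [j Hj] : exists j, (1 - d) ^+ j * 8 <= s0.
  pose j := Num.truncn (8 / (d * s0)).
  exists j.+1.
  have j8 : 8 <= j.+1%:R * d * s0.
    have := ltW (truncnS_gt (8 / (d * s0))).
    by rewrite ler_pdivrMr ?mulr_gt0 // mulrA.
  have e1 : (1 - d) ^+ j.+1 <= expR (- (j.+1%:R * d)).
    rewrite -mulrN mulrC expRM_natr; apply: lerXn2r;
      rewrite ?nnegrE ?expR_ge0 //.
      exact: ltW.
    exact: expR_ge1Dx.
  apply: le_trans (ler_wpM2r _ e1) _ => //.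
  rewrite expRN mulrC ler_pdivrMr ?expR_gt0 //.
  apply: le_trans j8 _; rewrite mulrC ler_wpM2l ?(ltW s0_gt0) //.
  by apply: le_trans (expR_ge1Dx _); rewrite lerDr.
by have := H j omega; rewrite max_l.
Qed.

End Contraction.

(** * Free families *)

Section Free.
Local Open Scope group_scope.
Implicit Types (omega : nat -> 'I_3) (g h : tree_aut) (y z : letter).

Definition inG omega g := exists w, ev omega w = g.

Lemma inG1 omega : inG omega 1.
Proof. by exists [::]; rewrite ev_nil. Qed.

Lemma inGM omega g h : inG omega g -> inG omega h -> inG omega (g * h).
Proof. by move=> [v <-] [w <-]; exists (v ++ w); rewrite ev_cat. Qed.

Lemma inGV omega g : inG omega g -> inG omega g^-1.
Proof. by move=> [w <-]; exists (rev w); rewrite ev_rev. Qed.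

Lemma inG_gen omega u : inG omega (gen omega u).
Proof. by exists [:: u]; rewrite ev_cons ev_nil mulg1. Qed.

Lemma inG_a omega : inG omega aut_a.
Proof. exact: (inG_gen omega None). Qed.

Lemma inG_let omega y : inG omega (let_aut omega y).
Proof. exact: (inG_gen omega (Some y)). Qed.

Lemma let_aut_x omega : let_aut omega x_letter = aut_x.
Proof. by congr aut_of_seq; apply/funext => n; rewrite ffunE. Qed.

Lemma inG_x omega : inG omega aut_x.
Proof. by rewrite -(let_aut_x omega); exact: inG_let. Qed.

Lemma aut_xE : aut_x = br false aut_a aut_x.
Proof. exact: aut_of_seqE. Qed.

Lemma brX g h n : br false g h ^+ n = br false (g ^+ n) (h ^+ n).
Proof.
elim: n => [|n IH]; first by rewrite !expg0 br1.
by rewrite !expgS IH brM.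
Qed.

Lemma brV g h : (br false g h)^-1 = br false g^-1 h^-1.
Proof. by apply: mulg1_eq; rewrite brM /= !mulgV br1. Qed.

Lemma expg_swap g h n : (g * h) ^+ n.+1 = g * (h * g) ^+ n * h.
Proof.
elim: n => [|n IH]; first by rewrite expg1 expg0 mulg1.
by rewrite expgS IH [(h * g) ^+ n.+1]expgS !mulgA.
Qed.

(** It behaves like the binary odometer: it switches the first letter, and its square has its
    inverse and itself as sections. *)
Definition adding : tree_aut := aut_x * aut_a.

Lemma addingE : adding = br true aut_x aut_a.
Proof. by rewrite /adding {1}aut_xE [X in _ * X]aut_aE brM /= !mulg1. Qed.

Lemma adding_sqr : adding * adding = br false (aut_a * aut_x) adding.
Proof. by rewrite addingE brM /= -addingE. Qed.

(** Descent: an odd power switches the first letter, and an even power has the power of half the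
    exponent as a section. *)
Lemma adding_order n : adding ^+ n = 1 -> n = 0%N.
Proof.
have [m] := ubnP n; elim: m n => // m IH n nm; rewrite -(odd_double_half n).
rewrite expgnDr -mul2n expgnA expg2 adding_sqr brX -br1.
case: (odd n) => /=.
  by rewrite expg1 addingE brM => /br_inj[].
rewrite expg0 mul1g => /br_inj[_ _].
by have [->|h0] := posnP n./2 => // /IH ->//; move: nm h0; lia.
Qed.

Lemma adding_inj n m : adding ^+ n = adding ^+ m -> n = m.
Proof.
wlog nm : n m / (n <= m)%N.
  by move=> H; case/orP: (leq_total n m) => nm /esym E;
    [|symmetry]; apply: H => //.
rewrite -{1}(subnKC nm) expgnDr -{1}[adding ^+ n]mulg1 => /mulgI /esym.
by move=> /adding_order; lia.
Qed.

Lemma aVadding : aut_a * aut_x = adding^-1.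
Proof.
symmetry; apply: mulg1_eq.
rewrite /adding mulgA -[_ * aut_a * aut_a]mulgA mulaa mulg1.
by rewrite -(let_aut_x (fun=> ord0)) let_autV.
Qed.

Lemma seq_aE (s : nat -> bool) : aut_of_seq s * aut_a =
  br true (aut_of_seq (fun n => s n.+1)) (if s 0%N then aut_a else 1).
Proof. by rewrite aut_of_seqE [X in _ * X]aut_aE brM /= !mulg1. Qed.

(** If the first term is P, the square has sections a s' and s' a, which are conjugate, with s' the
    shifted sequence; the induction applies to them. If it is I, both sections are the involution
    s'. *)
Lemma seq_a_order t (s : nat -> bool) : s t = false ->
  (aut_of_seq s * aut_a) ^+ (2 ^ t.+2) = 1.
Proof.
elim: t s => [|t IH] s st; rewrite expnS expgnA expg2;
  rewrite seq_aE brM /=;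
  set s' := aut_of_seq _.
  by rewrite st mulg1 mul1g brX !expg2 /s' aut_of_seqM -[RHS]br1 -aut_of_seq0;
    congr (br _ (aut_of_seq _) (aut_of_seq _)); apply/funext => n;
    rewrite addbb.
have E := IH (fun n => s n.+1) st; rewrite -/s' in E; rewrite brX -[RHS]br1.
case: (s 0%N); last first.
  rewrite !mulg1 !mul1g expnS expgnA expg2 /s' aut_of_seqM.
  suff -> : (fun n => s n.+1 (+) s n.+1) = fun=> false.
    by rewrite aut_of_seq0 expg1n.
  by apply/funext => n; rewrite addbb.
rewrite E; congr br; have : (2 ^ t.+2)%N = (2 ^ t.+2).-1.+1.
  by rewrite prednK // expn_gt0.
move: E => /[swap] -> E; rewrite expg_swap.
have -> : (s' * aut_a) ^+ (2 ^ t.+2).-1 = (s' * aut_a)^-1.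
  symmetry; apply: mulg1_eq; rewrite -expgS E //.
by rewrite invgM mulgA mulgV mul1g mulVg.
Qed.

(** * The rigid stabiliser of a subtree and its dihedral quotient *)

Section Rigid.
Variable omega : nat -> 'I_3.

Definition rigid g := inG omega (br false 1 g).

Lemma rigid1 : rigid 1.
Proof. by rewrite /rigid br1; exact: inG1. Qed.

Lemma rigidM g h : rigid g -> rigid h -> rigid (g * h).
Proof. by move=> gR /(inGM gR); rewrite brM /= mulg1. Qed.

Lemma rigidV g : rigid g -> rigid g^-1.
Proof. by move=> /inGV; rewrite brV invg1. Qed.

Lemma rigidX g n : rigid g -> rigid (g ^+ n).
Proof.
move=> gR; elim: n => [|n IH]; first exact: rigid1.
by rewrite expgS; exact: rigidM.
Qed.

(** A letter is its own section at 1, and a is the section at 1 of a x a. The left section [h] is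
    not controlled, but in [rigidJ] it only conjugates the identity. *)
Lemma lift_right g : inG (shift omega) g -> exists h, inG omega (br false h g).
Proof.
case=> w <-; elim: w => [|u w [h hG]].
  by exists 1; rewrite ev_nil br1; exact: inG1.
rewrite ev_cons.
have [k kG] : exists k, inG omega (br false k (gen (shift omega) u)).
  case: u => [y|].
    by have := inG_let omega y; rewrite let_autE => ?; eexists; eassumption.
  have : inG omega (aut_a * aut_x * aut_a).
    by apply: inGM (inG_a _); apply: inGM (inG_a _) (inG_x _).
  rewrite aut_xE {1 3}aut_aE !brM /= !mul1g !mulg1 => ?.
  by eexists; eassumption.
by exists (k * h); have := inGM kG hG; rewrite brM.
Qed.

Lemma rigidJ g h : inG (shift omega) h -> rigid g -> rigid (h * g * h^-1).
Proof.
move=> /lift_right[k kG] gR; have := inGM (inGM kG gR) (inGV kG).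
by rewrite brV !brM /= mulg1 mulgV.
Qed.

Definition cong g h := rigid (g * h^-1).

Lemma cong_refl g : cong g g.
Proof. by rewrite /cong mulgV; exact: rigid1. Qed.

Lemma congM g g' h h' : inG (shift omega) g ->
  cong g h -> cong g' h' -> cong (g * g') (h * h').
Proof.
move=> gG gh /(rigidJ gG) /rigidM /(_ gh).
by rewrite /cong invgM !mulgA mulgVK.
Qed.

Lemma inGX omega' g n : inG omega' g -> inG omega' (g ^+ n).
Proof.
by move=> gG; elim: n => [|n IH]; [exact: inG1 | rewrite expgS; exact: inGM].
Qed.

Lemma cong_trans h g k : cong g h -> cong h k -> cong g k.
Proof. by move=> /rigidM /[apply]; rewrite mulgA mulgVK. Qed.

Lemma congX g h n : inG (shift omega) g -> cong g h -> cong (g ^+ n) (h ^+ n).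
Proof.
move=> gG gh; elim: n => [|n IH]; first exact: cong_refl.
by rewrite !expgS; exact: congM.
Qed.

Lemma cong_rigid g h : cong g h -> rigid h -> rigid g.
Proof. by move=> /rigidM /[apply]; rewrite mulgVK. Qed.

Lemma rigid_let y : y (omega 0%N) = false -> rigid (let_aut (shift omega) y).
Proof. by move=> y0; have := inG_let omega y; rewrite let_autE y0. Qed.

Lemma cong_let y z : y (omega 0%N) = z (omega 0%N) ->
  cong (let_aut (shift omega) y) (let_aut (shift omega) z).
Proof.
move=> yz; rewrite /cong [_^-1](gen_inv _ (Some z)) /= let_autM.
by apply: rigid_let; rewrite ffunE yz addbb.
Qed.

Lemma adding_rigid n : omega n.+1 != omega 0%N ->
  rigid (adding ^+ (2 ^ n.+2)).
Proof.
(* This letter agrees with x at the first term of [omega], hence is congruent to it, but along the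
   shift it has an I at index [n], so [seq_a_order] applies. *)
move=> on; pose y : letter := [ffun j => j == omega 0%N].
apply: (@cong_rigid _ ((let_aut (shift omega) y * aut_a) ^+ (2 ^ n.+2))).
  apply: congX; first exact: inGM (inG_x _) (inG_a _).
  apply: congM (cong_refl _); first exact: inG_x.
  by rewrite -(let_aut_x (shift omega)); apply: cong_let; rewrite !ffunE eqxx.
by rewrite seq_a_order; [exact: rigid1 | rewrite ffunE; exact: negbTE].
Qed.

(** Modulo the rigid elements every letter is 1 or x, so that a and x generate. The inverse of
    [adding] is congruent to its power [q.-1], which keeps exponents natural. *)
Lemma cong_dihedral q g : (0 < q)%N -> rigid (adding ^+ q) ->
  inG (shift omega) g ->
  exists r (e : bool), cong g (adding ^+ r * (if e then aut_a else 1)).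
Proof.
move=> q0 qR [w <-]; elim/last_ind: w => [|w u [r [e IH]]].
  by exists 0%N, false; rewrite ev_nil mulg1; exact: cong_refl.
rewrite -cats1 ev_cat [ev _ [:: u]]ev_cons ev_nil mulg1.
have wG : inG (shift omega) (ev (shift omega) w) by exists w.
case: u => [y|] /=; last first.
  have H := congM wG IH (cong_refl aut_a); exists r, (~~ e).
  by case: e {IH} H => /=; rewrite -!mulgA ?mulaa ?mul1g.
have [y0|y0] := boolP (y (omega 0%N)); last first.
  exists r, e; rewrite -[X in cong _ X]mulg1; apply: congM => //.
  by rewrite /cong invg1 mulg1; apply: rigid_let; exact: negbTE.
have yx : cong (let_aut (shift omega) y) aut_x.
  by rewrite -(let_aut_x (shift omega)); apply: cong_let; rewrite ffunE y0.
have H := congM wG IH yx; case: e {IH} H => H.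
  exists (r + q.-1)%N, false; rewrite mulg1 expgnDr.
  have ax : cong (aut_a * aut_x) (adding ^+ q.-1).
    by rewrite /cong aVadding -invgM -expgSr prednK //; exact: rigidV.
  have rG : inG (shift omega) (adding ^+ r).
    by apply: inGX; exact: inGM (inG_x _) (inG_a _).
  by rewrite -mulgA in H; exact: cong_trans H (congM rG (cong_refl _) ax).
exists r.+1, true; move: H; rewrite mulg1.
by rewrite expgSr -!mulgA mulaa mulg1.
Qed.

(** In the dihedral quotient reflections have order dividing 2 and rotations order dividing q, so 2
    q kills everything. *)
Lemma rigid_power n : omega n.+1 != omega 0%N ->
  exists2 q, (0 < q)%N & forall g, inG (shift omega) g -> rigid (g ^+ q).
Proof.
move=> /adding_rigid; set q := (2 ^ _)%N => qR.
have q0 : (0 < q)%N by rewrite expn_gt0.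
exists (2 * q)%N => [|g gG]; first by rewrite muln_gt0.
have [r [e /(congX (2 * q) gG)]] := cong_dihedral q0 qR gG.
move=> /cong_rigid; apply; case: e.
  have -> : (adding ^+ r * aut_a) ^+ (2 * q) = 1.
    rewrite expgnA expg2 -mulgA.
    have -> : aut_a * (adding ^+ r * aut_a) = adding ^- r.
      rewrite -expVgn -aVadding; case: r => [|r].
        by rewrite !expg0 mul1g mulaa.
      by rewrite [RHS]expg_swap -/adding expgSr {2}/adding -!mulgA mulaa mulg1.
    by rewrite mulgV expg1n.
  exact: rigid1.
by rewrite mulg1 -expgnA mulnA mulnC expgnA; exact: rigidX.
Qed.

End Rigid.

Definition lin (gs : seq tree_aut) (ns : seq nat) : tree_aut :=
  \prod_(p <- zip gs ns) p.1 ^+ p.2.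

(** The order of the factors is fixed and commutation is not assumed. The sizes are prescribed
    because [zip] truncates. *)
Definition indep gs := forall ns ms, size ns = size gs -> size ms = size gs ->
  lin gs ns = lin gs ms -> ns = ms.

Lemma lin_nil ns : lin [::] ns = 1.
Proof. by case: ns => [|n ns]; rewrite /lin big_nil. Qed.

Lemma lin_nilr gs : lin gs [::] = 1.
Proof. by case: gs => [|g gs]; rewrite /lin big_nil. Qed.

Lemma lin_cat gs hs ns ms : size gs = size ns ->
  lin (gs ++ hs) (ns ++ ms) = lin gs ns * lin hs ms.
Proof. by move=> E; rewrite /lin zip_cat // big_cat. Qed.

Lemma lin_cons g gs n ns : lin (g :: gs) (n :: ns) = g ^+ n * lin gs ns.
Proof. by rewrite /lin big_cons. Qed.

Lemma lin_left q gs ns : lin [seq br false (g ^+ q) 1 | g <- gs] ns =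
  br false (lin gs (map (muln q) ns)) 1.
Proof.
elim: gs ns => [|g gs IH] [|n ns]; rewrite /= ?lin_nil ?lin_nilr ?br1 //.
by rewrite !lin_cons IH brX brM /= expg1n mulg1 expgnA.
Qed.

Lemma lin_right q gs ns : lin [seq br false 1 (g ^+ q) | g <- gs] ns =
  br false 1 (lin gs (map (muln q) ns)).
Proof.
elim: gs ns => [|g gs IH] [|n ns]; rewrite /= ?lin_nil ?lin_nilr ?br1 //.
by rewrite !lin_cons IH brX brM /= expg1n mulg1 expgnA.
Qed.

Lemma eventually_constant_shift omega :
  eventually_constant (shift omega) -> eventually_constant omega.
Proof.
move=> [c [N H]]; exists c, N.+1 => -[|n] // nN.
exact: (H n nN).
Qed.

(** Each step doubles the family: q-th powers of a family for the shift are placed below 1, and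
    conjugation by a moves them below 0. A product then splits into two coordinates, with all
    exponents multiplied by q. *)
Lemma indep_exists omega k : ~ eventually_constant omega ->
  exists gs,
    [/\ size gs = (2 ^ k)%N, forall g, g \in gs -> inG omega g & indep gs].
Proof.
elim: k omega => [|k IH] omega nec.
  exists [:: adding]; split=> [//|g|].
    by rewrite inE => /eqP ->; exact: inGM (inG_x _) (inG_a _).
  move=> [|n [|//]] // [|m [|//]] // _ _.
  by rewrite /lin !big_seq1 /= => /adding_inj ->.
have [n on] : exists n, omega n.+1 != omega 0%N.
  apply: contrapT => H; apply: nec; exists (omega 0%N), 1%N => -[|n] // _.
  by apply: contrapT => /eqP nE; apply: H; exists n.
have [q q0 qR] := rigid_power on.
have [gs [sz gsG ind]] :=
  IH (shift omega) (fun H => nec (eventually_constant_shift H)).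
pose L := [seq br false (g ^+ q) 1 | g <- gs].
pose L' := [seq br false 1 (g ^+ q) | g <- gs].
exists (L ++ L'); split.
- by rewrite size_cat !size_map sz expnS mul2n addnn.
- move=> g; rewrite mem_cat => /orP[] /mapP[h /gsG /qR hR ->] //.
  have := inGM (inGM (inG_a omega) hR) (inG_a omega).
  by rewrite aut_aE !brM /= !mul1g !mulg1.
- have E ns : size ns = (size gs + size gs)%N ->
      lin (L ++ L') ns =
      br false (lin gs (map (muln q) (take (size gs) ns)))
               (lin gs (map (muln q) (drop (size gs) ns))).
    move=> sn; rewrite -{1}(cat_take_drop (size gs) ns) lin_cat; last first.
      by rewrite size_map size_takel // sn leq_addr.
    by rewrite lin_left lin_right brM /= mulg1 mul1g.
  move=> ns ms; rewrite size_cat !size_map => sn sm.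
  have q_inj : injective (muln q).
    by move=> a b /eqP; rewrite eqn_pmul2l // => /eqP.
  rewrite !E // => /br_inj[_ /ind E1 /ind E2].
  rewrite -(cat_take_drop (size gs) ns) -(cat_take_drop (size gs) ms).
  by congr (_ ++ _); apply: (inj_map q_inj); [apply: E1 | apply: E2];
    rewrite size_map ?size_takel ?size_drop ?sn ?sm ?leq_addr ?addnK.
Qed.

End Free.

(** * Word balls and the standard generators *)

Section WordBalls.
Local Open Scope group_scope.
Variable gT : groupType.
Implicit Types (S : set gT) (g h : gT).

Lemma sub_generated S g : S g -> generated S g.
Proof. by move=> Sg H [_ SH]; exact: SH. Qed.

Lemma generated_subgroup S : subgroup (generated S).
Proof.
split=> [H [[]] //|g h gS hS H HS]; have [[_ HM] _] := HS.
by apply: HM; [exact: gS | exact: hS].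
Qed.

Lemma generated_min S (H : set gT) g :
  subgroup H -> (forall s, S s -> H s) -> generated S g -> H g.
Proof. by move=> Hsub SH; apply; split. Qed.

Lemma subgroupM (H : set gT) g h : subgroup H -> H g -> H h -> H (g * h).
Proof.
move=> [H1 HV] Hg Hh; rewrite -[h]invgK; apply: (HV _ _ Hg).
by rewrite -[h^-1]mul1g; exact: HV.
Qed.

Lemma word_ball1 S : word_ball S 0 1.
Proof. by exists [::]; split=> //; rewrite big_nil. Qed.

Lemma word_ballM S m n g h :
  word_ball S m g -> word_ball S n h -> word_ball S (m + n) (g * h).
Proof.
move=> [v [vm vS ->]] [w [wn wS ->]]; exists (v ++ w); split.
- by rewrite size_cat leq_add.
- by move=> s; rewrite mem_cat => /orP[/vS|/wS].
- by rewrite big_cat.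
Qed.

Lemma word_ballV S n g : word_ball S n g -> word_ball S n g^-1.
Proof.
move=> [w [wn wS ->]]; exists (rev [seq s^-1 | s <- w]); split.
- by rewrite size_rev size_map.
- move=> s; rewrite mem_rev => /mapP[t /wS tS ->]; rewrite invgK; tauto.
- by rewrite -map_rev big_map prodgV revK.
Qed.

Lemma word_ballX S k n g : word_ball S k g -> word_ball S (n * k) (g ^+ n).
Proof.
move=> gS; elim: n => [|n IH]; first by rewrite expg0; exact: word_ball1.
by rewrite expgS mulSn; exact: word_ballM.
Qed.

Lemma word_ball_le S m n g : (m <= n)%N -> word_ball S m g -> word_ball S n g.
Proof.
by move=> mn [w [wm wS ->]]; exists w; split=> //; exact: leq_trans mn.
Qed.

Lemma generated_ball S g : generated S g -> exists n, word_ball S n g.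
Proof.
apply: (generated_min (H := [set g | exists n, word_ball S n g])).
  split; first by exists 0%N; exact: word_ball1.
  by move=> h k [m hm] [n /word_ballV kn]; exists (m + n)%N; exact: word_ballM.
move=> s Ss; exists 1%N, [:: s]; split=> //; last by rewrite big_seq1.
by move=> t; rewrite inE => /eqP ->; left.
Qed.

Lemma generated_seq_ball S (gs : seq gT) :
  (forall g, g \in gs -> generated S g) ->
  exists k, forall g, g \in gs -> word_ball S k g.
Proof.
elim: gs => [|g gs IH] H; first by exists 0%N.
have [k Hk] : exists k, forall g, g \in gs -> word_ball S k g.
  by apply: IH => h hgs; apply: H; rewrite inE hgs orbT.
have [n gn] := generated_ball (H g (mem_head _ _)).
exists (maxn n k) => h; rewrite inE => /orP[/eqP ->|/Hk].
  by apply: word_ball_le gn; rewrite leq_maxl.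
by apply: word_ball_le; rewrite leq_maxr.
Qed.

Lemma growth_le S n (gs : seq gT) : finite_set S ->
  (forall g, word_ball S n g -> g \in gs) -> (growth S n <= size gs)%N.
Proof.
move=> fS H; apply: uniq_leq_size (fset_uniq _) _ => g.
by rewrite (in_fset_set (finite_word_ball n fS)) inE => /H.
Qed.

Lemma growth_ge S n (gs : seq gT) : finite_set S -> uniq gs ->
  (forall g, g \in gs -> word_ball S n g) -> (size gs <= growth S n)%N.
Proof.
move=> fS us H; apply: uniq_leq_size us _ => g ggs.
by rewrite (in_fset_set (finite_word_ball n fS)) inE; exact: H.
Qed.

End WordBalls.

Section Generators.
Local Open Scope group_scope.
Variable omega : nat -> 'I_3.

Definition std_gens : seq tree_aut :=
  [:: aut_a; aut_b omega; aut_c omega; aut_d omega; aut_x].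

Lemma overgroupE : overgroup omega = generated [set` std_gens].
Proof. by []. Qed.

Lemma seq_let (y : letter) (s : nat -> bool) : (forall n, s n = y (omega n)) ->
  aut_of_seq s = let_aut omega y.
Proof. by move=> H; congr aut_of_seq; apply/funext. Qed.

Lemma std_gens_gen s : s \in std_gens -> exists u, s = gen omega u.
Proof.
rewrite !inE => /orP[/eqP ->|/orP[/eqP ->|/orP[/eqP ->|/orP[]/eqP ->]]].
- by exists None.
- exists (Some [ffun i : 'I_3 => i != 2%N :> nat]).
  by apply: seq_let => n; rewrite ffunE.
- exists (Some [ffun i : 'I_3 => i != 1%N :> nat]).
  by apply: seq_let => n; rewrite ffunE.
- exists (Some [ffun i : 'I_3 => i != 0%N :> nat]).
  by apply: seq_let => n; rewrite ffunE.
- by exists (Some x_letter); rewrite /= let_aut_x.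
Qed.

Lemma std_ball_word n g : word_ball [set` std_gens] n g ->
  exists2 w, (size w <= n)%N & ev omega w = g.
Proof.
move=> [v [vn vS ->]]; suff [w sw <-] : exists2 w, size w = size v &
    ev omega w = \prod_(s <- v) s by exists w; rewrite ?sw.
elim: v vS {vn} => [|s v IH] vS.
  by exists [::]; rewrite // ev_nil big_nil.
have [|w sw ew] := IH; first by move=> t tv; apply: vS; rewrite inE tv orbT.
have [u su] : exists u, s = gen omega u.
  have [/std_gens_gen //|/std_gens_gen [u su]] := vS s (mem_head _ _).
  by exists u; rewrite -gen_inv -su invgK.
by exists (u :: w); rewrite /= ?sw // ev_cons ew big_cons su.
Qed.

Lemma overgroup_inG g : overgroup omega g -> inG omega g.
Proof.
by rewrite overgroupE => /generated_ball[n /std_ball_word[w _ wg]]; exists w.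
Qed.

(** Multiplying b, c and d by x gives the letters that are P at a single value (2, 1 and 0), and
    every letter is a product of these. *)
Lemma inG_overgroup g : inG omega g -> overgroup omega g.
Proof.
rewrite overgroupE; have sub := generated_subgroup [set` std_gens].
have sG s : s \in std_gens -> generated [set` std_gens] s.
  exact: sub_generated.
pose e j : letter := [ffun i : 'I_3 => i == j :> nat].
have eG j s : s \in std_gens -> s = aut_of_seq (fun n => omega n != j :> nat) ->
    generated [set` std_gens] (let_aut omega (e j)).
  move=> /sG sS sE; have -> : let_aut omega (e j) = aut_x * s.
    rewrite sE aut_of_seqM; symmetry.
    by apply: seq_let => n; rewrite ffunE /= negbK.
  by apply: (subgroupM sub) sS; apply: sG; rewrite !inE eqxx ?orbT.
have e2G : generated [set` std_gens] (let_aut omega (e 2%N)).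
  by apply: (eG 2%N (aut_b omega)); rewrite ?inE ?eqxx ?orbT.
have e1G : generated [set` std_gens] (let_aut omega (e 1%N)).
  by apply: (eG 1%N (aut_c omega)); rewrite ?inE ?eqxx ?orbT.
have e0G : generated [set` std_gens] (let_aut omega (e 0%N)).
  by apply: (eG 0%N (aut_d omega)); rewrite ?inE ?eqxx ?orbT.
have yG (y : letter) : generated [set` std_gens] (let_aut omega y).
  have -> : let_aut omega y =
    (if y (inord 0) then let_aut omega (e 0%N) else 1) *
    (if y (inord 1) then let_aut omega (e 1%N) else 1) *
    (if y (inord 2) then let_aut omega (e 2%N) else 1).
    have E (b : bool) (z : letter) : (if b then let_aut omega z else 1) =
        aut_of_seq (fun n => b && z (omega n)).
      by case: b => //=; rewrite -aut_of_seq0.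
    rewrite !E !aut_of_seqM; symmetry; apply: seq_let => n; rewrite !ffunE.
    have -> : y (omega n) = y (inord (omega n)) by rewrite inord_val.
    by case: (omega n) => -[|[|[|m]]] //= _; rewrite ?andbT ?andbF ?addbF ?addFb.
  have [G1 _] := sub.
  by apply: (subgroupM sub); [apply: (subgroupM sub)|]; case: ifP.
move=> [w <-]; elim: w => [|[y|] w IH]; rewrite ?ev_nil ?ev_cons.
- by have [] := sub.
- exact: (subgroupM sub (yG y) IH).
- by apply: (subgroupM sub) => //; apply: sG; rewrite !inE eqxx.
Qed.

Lemma finite_std_gens : finite_set [set` std_gens].
Proof. exact: finite_seq. Qed.

Lemma std_gensP : finite_generating_set (overgroup omega) [set` std_gens].
Proof. by split; [exact: finite_std_gens | rewrite overgroupE]. Qed.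

End Generators.

(** * Polynomial covers of balls for eventually constant sequences *)

Section EventuallyConstant.
Local Open Scope group_scope.
Implicit Types (omega : nat -> 'I_3).

Definition poly_cover omega :=
  exists C d : nat, forall n, exists gs : seq tree_aut,
  (size gs <= C * n.+1 ^ d)%N /\ forall w, (size w <= n)%N -> ev omega w \in gs.

Lemma size_sec omega x w : (size (sec omega x w) <= size w)%N.
Proof.
elim: w => //= -[y|] w IH; last exact: leq_trans (leqnSn _).
by case: ifP => _ //=; case: ifP => _ //=; exact: leq_trans (leqnSn _).
Qed.

(** Sections of a word are no longer than the word, so an element of the ball is given by a parity
    and two elements of the ball of the shift. The degree doubles. *)
Lemma poly_cover_shift omega : poly_cover (shift omega) -> poly_cover omega.
Proof.
move=> [C [d H]]; exists (2 * (C * C))%N, (2 * d)%N => n.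
have [gs [sgs Hgs]] := H n.
exists [seq br b p.1 p.2 | b <- [:: false; true],
                           p <- [seq (g, h) | g <- gs, h <- gs]].
split.
  by rewrite !size_allpairs /= -mulnA leq_mul // mul2n -addnn expnD mulnACA leq_mul.
move=> w wn; rewrite ev_sec; apply/allpairsP.
exists (par w, (ev (shift omega) (sec omega false w),
                ev (shift omega) (sec omega true w))); split=> //=.
  by case: (par w).
by apply/allpairsP; eexists (_, _); split=> //; apply: Hgs;
  exact: leq_trans (size_sec _ _ _) wn.
Qed.

(** Every letter acts as 1 or x, so each word has a normal form in the dihedral group. The integer
    exponent of [adding] is kept as a difference of two naturals with sum at most the length. *)
Lemma poly_cover_const omega c : (forall n, omega n = c) -> poly_cover omega.
Proof.
move=> oc; exists 2, 2 => n.
pose F (t : bool * 'I_n.+1 * 'I_n.+1) := adding ^+ t.1.2 * adding ^- t.2 *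
  (if t.1.1 then aut_a else 1).
exists (codom F); split.
  by rewrite size_codom !card_prod card_bool card_ord mulnA.
move=> w wn; suff [p [m [e [pm ->]]]] : exists p m (e : bool),
    (p + m <= size w)%N /\
    ev omega w = adding ^+ p * adding ^- m * (if e then aut_a else 1).
  have pn : (p < n.+1)%N by lia.
  have mn : (m < n.+1)%N by lia.
  exact: (codom_f F (e, Ordinal pn, Ordinal mn)).
elim/last_ind: w {wn} => [|w u [p [m [e [pm E]]]]].
  by exists 0%N, 0%N, false; rewrite ev_nil !expg0 invg1 !mulg1.
rewrite size_rcons -cats1 ev_cat E [ev _ [:: u]]ev_cons ev_nil mulg1.
case: u => [y|] /=; last first.
  exists p, m, (~~ e); split; first exact: leq_trans pm _.
  by case: e {E}; rewrite /= -!mulgA ?mulaa ?mul1g.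
have -> : let_aut omega y = if y c then aut_x else 1.
  rewrite /let_aut; under eq_fun do rewrite oc.
  by case: (y c) => //; exact: aut_of_seq0.
case: (y c); last first.
  by exists p, m, e; split; [exact: leq_trans pm _ | rewrite mulg1].
case: e {E}.
  exists p, m.+1, false; split; first by rewrite addnS.
  by rewrite mulg1 -!mulgA aVadding expgS (invgM adding).
exists p.+1, m, true; split=> //; rewrite mulg1 expgSr.
have C : commute (adding ^- m) adding.
  by apply/commute_sym/commuteV/commuteX/commute_refl.
rewrite -[adding ^+ p * adding * _]mulgA -C -!mulgA; congr (_ * (_ * _)).
by rewrite mulaa mulg1.
Qed.

Lemma eventually_constant_cover omega :
  eventually_constant omega -> poly_cover omega.
Proof.
move=> [c [N]]; elim: N omega => [|N IH] omega H.
  by apply: (poly_cover_const (c := c)) => n; exact: H.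
by apply/poly_cover_shift/IH => n Nn; exact: H.
Qed.

End EventuallyConstant.

(** * Growth of the overgroups *)

Section Main.
Local Open Scope classical_set_scope.
Local Open Scope ring_scope.
Variable R : realType.
Implicit Types (omega : nat -> 'I_3) (S : set tree_aut).

Lemma overgroup_polynomial omega : eventually_constant omega ->
  polynomial_growth R (overgroup omega).
Proof.
move=> /eventually_constant_cover[C [d H]].
exists [set` std_gens omega]; first exact: std_gensP.
exists (C%:R *: ('X + 1) ^+ d) => n; have [gs [sgs Hgs]] := H n.
rewrite hornerZ horner_exp !hornerE natr1 -natrX -natrM ler_nat.
apply: leq_trans sgs; apply: growth_le; first exact: finite_std_gens.
by move=> g /std_ball_word[w wn <-]; exact: Hgs.
Qed.

Lemma horner_le (p : {poly R}) : exists2 C : R, 0 <= C &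
  forall x, 0 <= x -> p.[x] <= C * (1 + x) ^+ size p.
Proof.
exists (\sum_(i < size p) `|p`_i|); first exact: sumr_ge0.
move=> x x0; rewrite horner_coef mulr_suml; apply: ler_sum => i _.
apply: (@le_trans _ _ (`|p`_i| * x ^+ i)).
  by rewrite ler_wpM2r ?exprn_ge0 ?ler_norm.
rewrite ler_wpM2l //; apply: (@le_trans _ _ ((1 + x) ^+ i)).
  by rewrite lerXn2r ?nnegrE ?addr_ge0 // lerDr.
by rewrite ler_weXn2l ?lerDl // ltnW.
Qed.

(** An independent family of r elements of length at most k gives (n + 1)^r distinct products of
    length at most r n k, and r exceeds the degree of the supposed bound. *)
Lemma overgroup_not_polynomial omega : ~ eventually_constant omega ->
  ~ polynomial_growth R (overgroup omega).
Proof.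
move=> nec [S [fS genS] [p Hp]]; have [C C0 HC] := horner_le p.
pose r := (2 ^ (size p).+1)%N.
have pr : (size p < r)%N by apply: ltn_trans (ltn_expl _ _); rewrite ?ltnSn.
have [gs [sgs gsG ind]] := indep_exists (size p).+1 nec; rewrite -/r in sgs.
have [k Hk] : exists k, forall g, g \in gs -> word_ball S k g.
  apply: generated_seq_ball => g /gsG /inG_overgroup.
  by rewrite genS.
have grow n : (n.+1 ^ r <= growth S (r * (n * k)))%N.
  pose L := [seq lin gs (map val t) | t : r.-tuple 'I_n.+1].
  have -> : (n.+1 ^ r = size L)%N by rewrite size_image card_tuple card_ord.
  apply: growth_ge => //.
    apply/injectiveP => t1 t2 /ind.
    rewrite !size_map !size_tuple sgs => /(_ erefl erefl).
    by move=> /(inj_map val_inj) /val_inj.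
  move=> _ /fintype.imageP[t _ ->].
  have tn m : m \in map val t -> (m <= n)%N.
    by move=> /mapP[i _ ->]; rewrite -ltnS; exact: (ltn_ord i).
  have : size (map val t) = size gs by rewrite size_map size_tuple sgs.
  suff H ms hs : (forall g, g \in hs -> word_ball S k g) ->
      (forall m, m \in ms -> (m <= n)%N) -> size ms = size hs ->
      word_ball S (size hs * (n * k)) (lin hs ms).
    by move: (map val t) tn => ms tn; rewrite -sgs; exact: H.
  elim: ms hs => [|m ms IH] [|g hs] //= {}Hk Hn.
    by move=> _; rewrite lin_nil; exact: word_ball1.
  move=> [E]; rewrite lin_cons mulSn; apply: word_ballM.
    apply: (@word_ball_le _ _ (m * k)%N).
      by rewrite leq_mul2r Hn ?mem_head ?orbT.
    by apply: word_ballX; apply: Hk; exact: mem_head.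
  apply: IH => // [h hhs|j jms]; [apply: Hk | apply: Hn];
    by rewrite inE ?hhs ?jms orbT.
(* Since 1 + r n k <= (1 + r k) (n + 1), dividing by (n + 1)^(size p) leaves n + 1 bounded by a
   constant. *)
pose D := C * (1 + (r * k)%:R) ^+ size p.
have bnd n : n.+1%:R <= D.
  have n1 : 1 <= n.+1%:R :> R by rewrite ler1n.
  have n0 : 0 < n.+1%:R :> R by [].
  rewrite -(@ler_pM2r _ (n.+1%:R ^+ size p)) ?exprn_gt0 // -exprS.
  apply: (@le_trans _ _ (n.+1%:R ^+ r)); first by rewrite ler_weXn2l.
  rewrite -natrX; apply: (@le_trans _ _ (growth S (r * (n * k)))%:R).
    by rewrite ler_nat.
  apply: le_trans (Hp _) _; apply: le_trans (HC _ _) _ => //.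
  rewrite -mulrA ler_wpM2l // -exprMn lerXn2r ?nnegrE ?mulr_ge0 ?addr_ge0 //.
  by rewrite !nat1r -natrM ler_nat; nia.
have := bnd (Num.truncn D); rewrite leNgt => /negP; apply.
exact: truncnS_gt.
Qed.

Lemma std_words omega S : finite_set S -> S `<=` inG omega ->
  exists k, forall n g, word_ball S n g ->
  exists2 w, ev omega w = g & (wtw 0 omega w <= k * n)%N.
Proof.
move=> /finite_seqP[ss ->] ssG.
have [k Hk] : exists k, forall s, s \in ss ->
    exists2 w, ev omega w = s & (wtw 0 omega w <= k)%N.
  elim: ss ssG => [|s ss IH] ssG; first by exists 0%N.
  have [|k Hk] := IH; first by move=> t tss; apply: ssG; rewrite /= inE tss orbT.
  have [|w ws] := ssG s; first by rewrite /= mem_head.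
  exists (maxn (wtw 0 omega w) k) => t; rewrite inE => /orP[/eqP ->|/Hk[v vt vk]].
    by exists w; rewrite // leq_maxl.
  by exists v; rewrite // leq_max vk orbT.
exists k => n g [v [vn vS ->]].
suff [w wv wk] : exists2 w, ev omega w = (\prod_(s <- v) s)%g &
    (wtw 0 omega w <= k * size v)%N.
  by exists w => //; apply: leq_trans wk _; rewrite leq_mul2l vn orbT.
elim: v vS {vn} => [|s v IH] vS.
  by exists [::]; [rewrite ev_nil big_nil | rewrite /wtw big_nil].
have [|w wv wk] := IH; first by move=> t tv; apply: vS; rewrite inE tv orbT.
have [u us uk] : exists2 u, ev omega u = s & (wtw 0 omega u <= k)%N.
  have [/Hk //|/Hk[u us uk]] := vS s (mem_head _ _).
  exists (rev u); first by rewrite ev_rev us invgK.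
  by rewrite /wtw (perm_big u) // perm_rev.
exists (u ++ w); first by rewrite ev_cat us wv big_cons.
by rewrite /wtw big_cat /= mulnS leq_add.
Qed.

(** Elements of the ball of radius n have weight at most k n, so at exponent s / (k + 1) each
    contributes at least exp (- s n) to a sum bounded by C. Using k + 1 avoids a division by
    zero. *)
Lemma overgroup_subexp omega S (s : R) : finite_set S -> S `<=` inG omega ->
  0 < s -> exists C : R, forall n, (growth S n)%:R <= C * expR (s * n%:R).
Proof.
move=> fS SG s0; have [k Hk] := std_words fS SG.
have sk0 : 0 < s / k.+1%:R by rewrite divr_gt0.
have [C HC] := exp_summable_all omega sk0; have [r Hr] := min_word 0 omega.
exists C => n; pose gs := enum_fset (fset_set (word_ball S n)).
have gsP g : g \in gs -> exists2 w, ev omega w = g & (wtw 0 omega w <= k * n)%N.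
  by rewrite (in_fset_set (finite_word_ball n fS)) inE => /Hk.
rewrite -ler_pdivrMr ?expR_gt0 // -expRN.
apply: le_trans (HC (map r gs) _); last first.
  rewrite -map_comp map_id_in ?fset_uniq // => g /gsP[w <- _].
  by have [] := Hr w.
rewrite big_map big_seq.
apply: (@le_trans _ _ (\sum_(g <- gs | g \in gs) expR (- (s * n%:R)))).
  by rewrite -big_seq big_const_seq count_predT iter_addr_0 mulr_natl.
apply: ler_sum => g /gsP[w <- wk]; have [_ H] := Hr w.
rewrite ler_expR lerN2 -mulrA ler_pM2l // mulrC ler_pdivrMr // -natrM ler_nat.
apply: leq_trans H _; apply: leq_trans wk _.
by rewrite mulnC leq_mul2l leqnSn orbT.
Qed.

Lemma overgroup_not_exponential omega :
  ~ exponential_growth R (overgroup omega).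
Proof.
move=> [S [fS genS] [l l1 cvg]].
have SG : S `<=` inG omega.
  by move=> g /sub_generated; rewrite genS => /overgroup_inG.
pose l' : R := (1 + l) / 2; have l'1 : 1 < l' by rewrite /l'; lra.
have l'0 : 0 < l' by apply: lt_trans l'1.
have L0 : 0 < ln l' by rewrite ln_gt0.
have s0 : 0 < ln l' / 2 by rewrite divr_gt0.
have [C HC] := overgroup_subexp fS SG s0.
have : \forall n \near \oo, l' < (growth S n)%:R `^ (n%:R^-1) :> R.
  by apply: (cvgr_gt l cvg); rewrite /l'; lra.
move=> [N _ HN].
(* For large n the growth is at least l'^n, while it is at most C exp (n ln l' / 2), so exp (n ln l'
   / 2) <= C. The index [n.+1] makes the inverse exponent a true inverse. *)
have bnd n : (N <= n)%N -> 1 + ln l' / 2 * n.+1%:R <= C.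
  move=> Nn; have /= H := HN n.+1 (leqW Nn).
  apply: le_trans (expR_ge1Dx _) _.
  rewrite -(@ler_pM2r _ (expR (ln l' / 2 * n.+1%:R))) ?expR_gt0 //.
  apply: le_trans (HC n.+1); rewrite -expRD -mulrDl -splitr.
  rewrite expRM_natr lnK ?posrE //.
  have -> : (growth S n.+1)%:R =
      ((growth S n.+1)%:R `^ (n.+1%:R^-1)) ^+ n.+1 :> R.
    by rewrite -powR_mulrn ?powR_ge0 // -powRrM mulVf ?powRr1 // pnatr_eq0.
  by apply: lerXn2r; rewrite ?nnegrE ?powR_ge0 //; exact: ltW.
pose M := maxn N (Num.truncn (C / (ln l' / 2))).
have := bnd M (leq_maxl _ _); apply/negP; rewrite -ltNge.
have : C < ln l' / 2 * M.+1%:R.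
  rewrite mulrC -ltr_pdivrMr //; apply: lt_le_trans (truncnS_gt _) _.
  by rewrite ler_nat ltnS leq_maxr.
by lra.
Qed.

End Main.

Theorem theorem1 (R : realType) (omega : nat -> 'I_3) :
  (eventually_constant omega -> polynomial_growth R (overgroup omega)) /\
  (~ eventually_constant omega -> intermediate_growth R (overgroup omega)).
Proof.
split=> [|nec]; first exact: overgroup_polynomial.
split; last exact: overgroup_not_exponential.
  by eexists; exact: std_gensP.
exact: overgroup_not_polynomial.
Qed.
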